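(* Let $\mathscr{X}$ be a finite non-empty set and let $\overline{T}\colon \mathscr{L}(\mathscr{X})\to\mathscr{L}(\mathscr{X})$ be a coherent upper transition operator. Then $\overline{T}$ is weakly ergodic if and only if it is top class absorbing.
   Context: $\mathbb{N}=\{1,2,\dots\}$ and $\mathbb{N}_0=\mathbb{N}\cup\{0\}$. For a finite non-empty set $\mathscr{X}$ (the state space), $\mathscr{L}(\mathscr{X})$ is the set of all real-valued functions on $\mathscr{X}$; inequalities between functions are pointwise and real constants are identified with constant functions. For $x\in\mathscr{X}$, $\mathbb{I}_x$ is the indicator of $\{x\}$, and $\mathbb{I}_A$ is the indicator of $A\subseteq\mathscr{X}$; $A^c=\mathscr{X}\setminus A$. A coherent upper transition operator is a map $\overline{T}\colon\mathscr{L}(\mathscr{X})\to\mathscr{L}(\mathscr{X})$ such that for all $h,g\in\mathscr{L}(\mathscr{X})$ and real $\lambda\ge 0$: (C1) $\min h\le\overline{T}h\le\max h$; (C2) $\overline{T}(h+g)\le\overline{T}h+\overline{T}g$; (C3) $\overline{T}(\lambda h)=\lambda\overline{T}h$. For $f\in\mathscr{L}(\mathscr{X})$ define $\overline{T}_f\colon\mathscr{L}(\mathscr{X})\to\mathscr{L}(\mathscr{X})$ by $\overline{T}_f h:=f+\overline{T}h$. The upper expected time average is $\overline{\mathrm{E}}_{\mathrm{av},k}(f\vert x):=\frac{1}{k+1}[\overline{T}_f^{\,k+1}(0)](x)$ for $k\in\mathbb{N}_0$, $x\in\mathscr{X}$, where $\overline{T}_f^{\,k+1}$ is the $(k+1)$-fold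 composition. $\overline{T}$ is weakly ergodic if, for every $f\in\mathscr{L}(\mathscr{X})$, the limit $\lim_{k\to+\infty}\overline{\mathrm{E}}_{\mathrm{av},k}(f\vert x)$ exists in $\mathbb{R}$ for all $x\in\mathscr{X}$ and does not depend on $x$. The upper accessibility graph $\mathscr{G}(\overline{T})$ is the directed graph with vertex set $\mathscr{X}$ and an edge from $x$ to $y$ iff $\overline{T}\mathbb{I}_y(x)>0$. Write $x\to y$ if $x=y$ or there is a directed path from $x$ to $y$. $\overline{T}$ has a top class if $\mathcal{R}:=\{x\in\mathscr{X}: y\to x\text{ for all }y\in\mathscr{X}\}$ is non-empty; $\mathcal{R}$ is then called its top class. $\overline{T}$ is top class absorbing if it has a top class $\mathcal{R}$ and for every $x\in\mathcal{R}^c$ there is a $k\in\mathbb{N}$ such that $\overline{T}^k\mathbb{I}_{\mathcal{R}^c}(x)<1$. *)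

(* Defs.v *)
From HB Require Import structures.
From mathcomp Require Import all_boot all_order all_algebra.
From mathcomp Require Import all_classical all_reals all_analysis.
Set Implicit Arguments.
Unset Strict Implicit.
Unset Printing Implicit Defensive.
Import Order.TTheory GRing.Theory Num.Theory.
Import numFieldNormedType.Exports.
Local Open Scope classical_set_scope.
Local Open Scope ring_scope.

Section Defs.
Variables (R : realType) (X : finType).
Local Notation L := {ffun X -> R}.

(* In (C1) the seed of the iterated min (resp. max) is the value [h x], itself
   one of the values of [h]; it only avoids naming a default element of [X],
   so the bounds are exactly [min h] and [max h]. *)
Record coherent (T : L -> L) : Prop := Coherent {
  coherent_bounds : forall (h : L) (x : X),
    \big[Num.min/h x]_y h y <= T h x <= \big[Num.max/h x]_y h y ;
  coherent_subadd : forall (h g : L) (x : X), T (h + g) x <= T h x + T g x ;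
  coherent_homog : forall (lambda : R) (h : L), 0 <= lambda ->
    T [ffun y => lambda * h y] = [ffun x => lambda * T h x] }.

Definition ind (A : {set X}) : L := [ffun x => (x \in A)%:R].

Definition shift_op (T : L -> L) (f : L) : L -> L := fun h => f + T h.

Definition upper_avg (T : L -> L) (f : L) (k : nat) (x : X) : R :=
  (k.+1%:R)^-1 * iter k.+1 (shift_op T f) 0 x.

Definition weakly_ergodic (T : L -> L) : Prop :=
  forall f : L,
    (forall x, cvgn (fun k => upper_avg T f k x)) /\
    (forall x y, limn (fun k => upper_avg T f k x) =
                 limn (fun k => upper_avg T f k y)).

Definition edge (T : L -> L) : rel X :=
  [rel x y | 0 < T (ind [set y]%SET) x].

Definition top_class (T : L -> L) : {set X} :=
  [set x | [forall y, connect (edge T) y x]]%SET.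

Definition has_top_class (T : L -> L) : Prop := top_class T != finset.set0.

Definition top_class_absorbing (T : L -> L) : Prop :=
  has_top_class T /\
  forall x, x \in ~: top_class T ->
    exists k : nat, (0 < k)%N /\ iter k T (ind (~: top_class T)) x < 1.

End Defs.

(* Main.v *)
Require Import Defs.
From mathcomp Require Import all_boot all_order all_algebra.
From mathcomp Require Import all_classical all_reals all_analysis.
From mathcomp Require Import ring lra.

(** Write [u_k] for the [k]-th iterate of [h |-> f + T h] at [0].

    Top class absorbing implies weakly ergodic: for fixed [n], [T^n u_k] stays
    within a constant of [u_k], uniformly in [k]. Evaluated at a minimiser [x]
    of [u_k], with [x -> y] witnessed by [T^n I_y (x) > 0], this bounds
    [u_k y - u_k x]; evaluated at a maximiser outside the top class [Rc], with
    [T^n I_(~Rc) < 1], it bounds the excess of [max u_k] over [max_Rc u_k].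
    Hence [u_k] has uniformly bounded span, so [k |-> u_k x] is additive up to
    a constant and [u_k x / k] is Cauchy.

    Weakly ergodic implies top class absorbing: if [y] and [z] had no common
    descendant, the indicator of the descendants of [z] would have averages
    [1] at [z] and at most [0] at [y]; so the graph is directed and, being
    finite, has a top class. If absorption failed at [x], the averages of the
    indicator of [~Rc] would be at least [1] at [x] and at most [0] on [Rc]. *)

(** * Averages of almost additive sequences *)

Section AlmostAdditive.
Import Order.TTheory GRing.Theory Num.Theory numFieldNormedType.Exports.
Local Open Scope classical_set_scope.
Local Open Scope ring_scope.
Context {R : realType}.

Lemma almost_additive_mul (a : nat -> R) (C : R) :
  (forall m n, `|a (m + n)%N - a m - a n| <= C) ->
  forall m n, `|a (n.+1 * m)%N - n.+1%:R * a m| <= n.+1%:R * C.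
Proof.
move=> Ha m; elim=> [|n IH].
  by rewrite mul1n !mul1r subrr normr0 (le_trans _ (Ha 0 0)%N).
rewrite mulSn -(natr1 n.+1).
have := Ha m (n.+1 * m)%N; move: IH; rewrite !ler_norml.
by move=> /andP[? ?] /andP[? ?]; apply/andP; split; lra.
Qed.

(** Comparing both [a m] and [a n] with [a (m * n)] makes the averages Cauchy with rate
    [C * (m^-1 + n^-1)]. *)
Lemma almost_additive_cvg (a : nat -> R) (C : R) :
  (forall m n, `|a (m + n)%N - a m - a n| <= C) ->
  cvgn (fun k => k.+1%:R^-1 * a k.+1).
Proof.
move=> Ha; have C0 : 0 <= C := le_trans (normr_ge0 _) (Ha 0 0)%N.
have key m n : `|m.+1%:R^-1 * a m.+1 - n.+1%:R^-1 * a n.+1| <=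
    C * (m.+1%:R^-1 + n.+1%:R^-1).
  have m0 : (0 : R) < m.+1%:R by [].
  have n0 : (0 : R) < n.+1%:R by [].
  have mn0 : (0 : R) < m.+1%:R * n.+1%:R by rewrite mulr_gt0.
  have e1 : m.+1%:R^-1 * a m.+1 - n.+1%:R^-1 * a n.+1 =
      (m.+1%:R * n.+1%:R)^-1 * (n.+1%:R * a m.+1 - m.+1%:R * a n.+1).
    by field; rewrite !lt0r_neq0.
  have e2 : C * (m.+1%:R^-1 + n.+1%:R^-1) =
      (m.+1%:R * n.+1%:R)^-1 * (n.+1%:R * C + m.+1%:R * C).
    by field; rewrite !lt0r_neq0.
  rewrite e1 e2 normrM gtr0_norm ?invr_gt0// ler_pM2l ?invr_gt0//.
  have := almost_additive_mul _ _ Ha m.+1 n.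
  have := almost_additive_mul _ _ Ha n.+1 m; rewrite mulnC !ler_norml.
  by move=> /andP[? ?] /andP[? ?]; apply/andP; split; lra.
apply: cauchy_cvg; apply: cauchy_exP => e e0.
(* Using [C + 1] keeps the denominator positive when [C = 0] and makes the final bound strict. *)
have d0 : 0 < e / (2 * (C + 1)) by rewrite divr_gt0// mulr_gt0// ltr_wpDl.
set d := e / _ in d0.
have [N _ HN] := near_infty_natSinv_lt (PosNum d0).
exists (N.+1%:R^-1 * a N.+1); exists N => // n /= leNn.
rewrite /ball/=.
apply: le_lt_trans (key N n) _.
have ltN : N.+1%:R^-1 < d := HN N (leqnn N).
have ltn : n.+1%:R^-1 < d := HN n leNn.
have -> : e = (C + 1) * (d + d).
  by rewrite /d; field; apply: lt0r_neq0; lra.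
apply: le_lt_trans (_ : C * (d + d) < _); last by rewrite ltr_pM2r; lra.
by apply: ler_wpM2l => //; apply: lerD; apply: ltW.
Qed.

Lemma bounded_diff_lim (a b : nat -> R) (C : R) :
  (forall k, `|a k - b k| <= C) ->
  cvgn (fun k => k.+1%:R^-1 * a k) -> cvgn (fun k => k.+1%:R^-1 * b k) ->
  limn (fun k => k.+1%:R^-1 * a k) = limn (fun k => k.+1%:R^-1 * b k).
Proof.
move=> HC ca cb; apply/eqP; rewrite -subr_eq0; apply/eqP.
rewrite -(limB ca cb); apply/cvg_lim => //.
have cC (c : R) : (fun k : nat => c * k.+1%:R^-1) @ \oo --> (0 : R).
  by rewrite -(mulr0 c); apply: cvgM; [exact: cvg_cst | exact: cvg_harmonic].
apply: squeeze_cvgr (cC (- C)) (cC C); near=> k.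
have k0 : (0 : R) < k.+1%:R^-1 by rewrite invr_gt0.
by rewrite !fctE -mulrBr ![_ * k.+1%:R^-1]mulrC !ler_pM2l// -ler_norml HC.
Unshelve. all: by end_near.
Qed.

End AlmostAdditive.

(** * Order properties of the iterates of [T] *)

Section UpperTransition.
Import Order.TTheory GRing.Theory Num.Theory numFieldNormedType.Exports.
Local Open Scope ring_scope.
Context {R : realType} {X : finType}.
Local Notation L := {ffun X -> R}.
Variable T : L -> L.
Hypothesis hT : coherent T.

Lemma bound_upper (h : L) (c : R) :
  (forall x, h x <= c) -> forall x, T h x <= c.
Proof.
move=> hc x; have /andP[_ le1] := coherent_bounds hT h x.
by apply: le_trans le1 _; apply: bigmax_le.
Qed.

(* Monotonicity, constant additivity and nonexpansiveness in one property. *)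
Definition topical (S : L -> L) : Prop := forall (h g : L) (c : R),
  (forall x, h x <= g x + c) -> forall x, S h x <= S g x + c.

(** Subadditivity on [h = g + (h - g)], whose second summand is at most [c]. *)
Lemma topical_upper : topical T.
Proof.
move=> h g c hg x; have -> : h = g + (h - g) by rewrite addrC subrK.
apply: le_trans (coherent_subadd hT g (h - g) x) _.
rewrite lerD2l; apply: bound_upper => y.
by rewrite !ffunE lerBlDl.
Qed.

Lemma topical_shift (f : L) : topical (shift_op T f).
Proof.
move=> h g c hg x; rewrite /shift_op !ffunE -addrA lerD2l.
exact: topical_upper.
Qed.

Lemma topical_iter (S : L -> L) n : topical S -> topical (iter n S).
Proof. by move=> St; elim: n => [//|n IH] h g c hg; apply/St/IH. Qed.

Lemma iter_homog n (a : R) (h : L) x : 0 <= a ->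
  iter n T [ffun y => a * h y] x = a * iter n T h x.
Proof.
move=> a0; suff -> : iter n T [ffun y => a * h y] = [ffun y => a * iter n T h y].
  by rewrite ffunE.
elim: n => [|n IH] /=; last by rewrite IH (coherent_homog hT).
by apply/ffunP => y; rewrite !ffunE.
Qed.

Lemma iter_le_affine n (h g : L) (a c : R) x : 0 <= a ->
  (forall z, h z <= a * g z + c) -> iter n T h x <= a * iter n T g x + c.
Proof.
move=> a0 hg; rewrite -iter_homog//.
by apply: (topical_iter _ _ topical_upper) => z; rewrite ffunE.
Qed.

Lemma iter_ge_affine n (h g : L) (a c : R) x : 0 <= a ->
  (forall z, a * g z + c <= h z) -> a * iter n T g x + c <= iter n T h x.
Proof.
move=> a0 hg; rewrite -iter_homog// -lerBrDr.
by apply: (topical_iter _ _ topical_upper) => z; rewrite ffunE lerBrDr.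
Qed.

Lemma iter_const_le n (h : L) (c : R) x :
  (forall z, h z <= c) -> iter n T h x <= c.
Proof.
move=> hc; have := @iter_le_affine n h h 0 c x (lexx _).
by rewrite mul0r add0r; apply => z; rewrite mul0r add0r.
Qed.

Lemma iter_const_ge n (h : L) (c : R) x :
  (forall z, c <= h z) -> c <= iter n T h x.
Proof.
move=> hc; have := @iter_ge_affine n h h 0 c x (lexx _).
by rewrite mul0r add0r; apply => z; rewrite mul0r add0r.
Qed.

(** * Indicators and the accessibility graph *)

Lemma ind_ge0 (A : {set X}) x : 0 <= ind R A x.
Proof. by rewrite ffunE ler0n. Qed.

Lemma ind_le1 (A : {set X}) x : ind R A x <= 1.
Proof. by rewrite ffunE lern1 leq_b1. Qed.

Lemma upper_sum_le (I : Type) (r : seq I) (P : pred I) (F : I -> L) x :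
  T (\sum_(i <- r | P i) F i) x <= \sum_(i <- r | P i) T (F i) x.
Proof.
elim/big_rec2: _ => [|i y h _ IH]; first by apply: bound_upper => z; rewrite ffunE.
by apply: le_trans (coherent_subadd hT _ _ _) _; rewrite lerD2l.
Qed.

(** Subadditivity reduces [A] to its singletons, where the absence of an edge is the claim. *)
Lemma upper_ind_le0 (A : {set X}) x :
  (forall y, y \in A -> ~~ edge T x y) -> T (ind R A) x <= 0.
Proof.
move=> noedge.
have -> : ind R A = \sum_(y in A) ind R [set y]%SET.
  apply/ffunP => z; rewrite sum_ffunE ffunE.
  rewrite (eq_bigr (fun y => (y == z)%:R)); last first.
    by move=> y _; rewrite ffunE inE eq_sym.
  case: (boolP (z \in A)) => zA.
    rewrite (bigD1 z)//= eqxx big1 ?addr0// => y /andP[_ /negPf ->]//.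
  rewrite big1// => y yA; case: eqP => // yz; by rewrite -yz yA in zA.
apply: le_trans (upper_sum_le _ _ _ _ _) _.
by apply: sumr_le0 => y /noedge; rewrite /edge /= -leNgt.
Qed.

(** Along an edge from [x] to [z], the bound [T^n I_y >= (T^n I_y z) * I_z] shows that
    [T^(n+1) I_y x] is at least a product of two positive numbers. *)
Lemma connect_iter_gt0 x y :
  connect (edge T) x y -> exists n, 0 < iter n T (ind R [set y]%SET) x.
Proof.
case/connectP => p; elim: p x => [x _ ->|z p IH x /= /andP[xz pz] yp].
  by exists 0%N; rewrite /= ffunE inE eqxx.
have [n n0] := IH z pz yp; exists n.+1.
set g := ind R [set y]%SET in n0 *.
have g0 w : 0 <= iter n T g w by apply: iter_const_ge => ?; apply: ind_ge0.
apply: lt_le_trans (_ : iter n T g z * T (ind R [set z]%SET) x + 0 <= _).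
  by rewrite addr0 mulr_gt0.
apply: (@iter_ge_affine 1) => // w; rewrite addr0 ffunE inE.
by case: eqP => [->|_]; rewrite ?mulr1 ?mulr0.
Qed.

(** * Uniformly bounded span of the iterates [u k] *)

Section Shift.
Variable f : L.
Local Notation u := (fun k => iter k (shift_op T f) 0).

Lemma iter_shift_near n (h : L) (F : R) : (forall x, `|f x| <= F) ->
  forall x, `|iter n (shift_op T f) h x - iter n T h x| <= n%:R * F.
Proof.
move=> fF; elim: n => [|n IH] x /=; first by rewrite subrr normr0 mul0r.
rewrite ffunE -natr1; set h1 := iter n _ _; set h2 := iter n T h.
have H z : - (n%:R * F) <= h1 z - h2 z <= n%:R * F by rewrite -ler_norml.
have le1 : T h1 x <= T h2 x + n%:R * F.
  by apply: topical_upper => z; have /andP[? ?] := H z; lra.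
have le2 : T h2 x <= T h1 x + n%:R * F.
  by apply: topical_upper => z; have /andP[? ?] := H z; lra.
have := fF x; rewrite !ler_norml => /andP[? ?].
by apply/andP; split; lra.
Qed.

(** Both terms are close to [u (n + k)]: [T^n (u k)] because [n] shifts add little, and [u k]
    because [k] shifts do not increase the distance between [u n] and [0]. *)
Lemma iter_shift_drift :
  exists2 F : R, 0 <= F & forall n k x, `|u k x - iter n T (u k) x| <= n%:R * F.
Proof.
pose F := \sum_x `|f x|.
have fF x : `|f x| <= F.
  by rewrite /F (bigD1 x)//= lerDl sumr_ge0.
exists (F + F) => [|n k x]; first by rewrite addr_ge0// /F sumr_ge0.
have un z : - (n%:R * F) <= u n z <= n%:R * F.
  rewrite -ler_norml; have := iter_shift_near n 0 F fF z.
  have -> : iter n T 0 z = 0; last by rewrite subr0.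
  by apply/eqP; rewrite eq_le iter_const_le ?iter_const_ge// => ?; rewrite ffunE.
have := iter_shift_near n (u k) F fF x.
have S1 : u (n + k)%N x <= u k x + n%:R * F.
  rewrite addnC iterD.
  apply: (topical_iter _ _ (topical_shift f)) => z; rewrite ffunE add0r.
  by have /andP[] := un z.
have S2 : u k x <= u (n + k)%N x + n%:R * F.
  rewrite [in leRHS]addnC iterD.
  apply: (topical_iter _ _ (topical_shift f)) => z; rewrite ffunE.
  by have /andP[? ?] := un z; lra.
rewrite -iterD !ler_norml => /andP[? ?].
by apply/andP; split; lra.
Qed.

(** At a minimiser, [u k >= (u k y - u k x) * I_y + u k x]. Applying [T^n] and the drift bound
    leaves [(u k y - u k x) * e <= n * F]. *)
Lemma minimiser_bound x y : connect (edge T) x y ->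
  exists C : R, forall k, (forall z, u k x <= u k z) -> u k y - u k x <= C.
Proof.
move=> /connect_iter_gt0[n e0]; have [F F0 HF] := iter_shift_drift.
set e := iter n T _ x in e0.
exists (n%:R * F / e) => k kmin; rewrite ler_pdivlMr//.
have := HF n k x; rewrite ler_norml => /andP[+ _].
suff : (u k y - u k x) * e + u k x <= iter n T (u k) x by lra.
apply: iter_ge_affine; first by rewrite subr_ge0.
move=> z; rewrite ffunE inE; case: eqP => [->|_]; first by rewrite mulr1 subrK.
by rewrite mulr0 add0r.
Qed.

(** Dually, [u k <= (u k x - M) * I_A + M], and the drift bound leaves
    [(u k x - M) * (1 - e) <= n * F]. *)
Lemma maximiser_bound (A : {set X}) x n : iter n T (ind R A) x < 1 ->
  exists2 C : R, 0 <= C & forall k M, (forall z, u k z <= u k x) ->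
    (forall z, z \notin A -> u k z <= M) -> M <= u k x -> u k x - M <= C.
Proof.
set e := iter n T _ x => e1; have [F F0 HF] := iter_shift_drift.
have e1' : 0 < 1 - e by rewrite subr_gt0.
exists (n%:R * F / (1 - e)) => [|k M kmax kM Mx].
  by rewrite divr_ge0 ?mulr_ge0// ltW.
rewrite ler_pdivlMr//.
have := HF n k x; rewrite ler_norml => /andP[_].
suff : iter n T (u k) x <= (u k x - M) * e + M by lra.
apply: iter_le_affine; first by rewrite subr_ge0.
move=> z; rewrite ffunE; case: (boolP (z \in A)) => zA.
  by rewrite mulr1 subrK.
by rewrite mulr0 add0r kM.
Qed.

Lemma span_bounded : top_class_absorbing T ->
  exists C : R, forall k x y, u k x - u k y <= C.
Proof.
move=> [/finset.set0Pn[r rR] absorb].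
set Rc := top_class T in rR absorb.
(* The constants depend on states but not on [k]; finiteness of [X] allows summing them. Unconnected
   pairs get the default [0]. *)
have /choice[Cl HCl] : forall p : X * X, exists C : R, connect (edge T) p.1 p.2 ->
    forall k, (forall z, u k p.1 <= u k z) -> u k p.2 - u k p.1 <= C.
  move=> [x y] /=; case: (boolP (connect (edge T) x y)) => [|_]; last by exists 0.
  by move=> /minimiser_bound[C HC]; exists C.
have /choice[Cu HCu] : forall x, exists C : R, 0 <= C /\
    forall k M, (forall z, u k z <= u k x) ->
    (forall z, z \in Rc -> u k z <= M) -> M <= u k x -> u k x - M <= C.
  move=> x; case: (boolP (x \in Rc)) => xR.
    exists 0; split=> // k M _ kM _; rewrite subr_le0; exact: kM.
  have [|n [_ n1]] := absorb x; first by rewrite inE.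
  have [C C0 HC] := maximiser_bound _ _ _ n1; exists C; split=> // k M kmax kM Mx.
  by apply: HC => // z; rewrite inE negbK; exact: kM.
pose B := \sum_p `|Cl p|; pose D := \sum_x Cu x.
have lB p : Cl p <= B.
  by apply: le_trans (ler_norm _) _; rewrite /B (bigD1 p)//= lerDl sumr_ge0.
have lD x : Cu x <= D.
  rewrite /D (bigD1 x)//= lerDl sumr_ge0// => i _; exact: (HCu i).1.
exists (B + D) => k x y.
(* The span is split at a maximiser [s] over the top class, which is reachable from the global
   minimiser [m]. *)
case: (@arg_minP _ _ _ y xpredT (fun z => u k z) isT) => m _ /(_ _ isT) mmin.
case: (@arg_maxP _ _ _ x xpredT (fun z => u k z) isT) => M _ /(_ _ isT) Mmax.
case: (@arg_maxP _ _ _ r (mem Rc) (fun z => u k z) rR) => s sR smax.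
have ms : connect (edge T) m s.
  by have : s \in top_class T := sR; rewrite inE => /forallP.
have h1 := le_trans (HCl (m, s) ms k mmin) (lB _).
have h2 := le_trans ((HCu M).2 k (u k s) Mmax smax (Mmax s)) (lD _).
have := mmin y; have := Mmax x; move: h1 h2 => /=.
by lra.
Qed.

(** [u (m + n)] is [m] shifts of [u n], and [u n] is within [C] of the constant [u n x]. *)
Lemma almost_additive_shift (C : R) : (forall k x y, u k x - u k y <= C) ->
  forall x m n, `|u (m + n)%N x - u m x - u n x| <= C.
Proof.
move=> HC x m n.
have S1 : u (m + n)%N x <= u m x + (u n x + C).
  rewrite iterD; apply: (topical_iter _ _ (topical_shift f)) => z.
  by rewrite ffunE add0r; have := HC n z x; lra.
have S2 : u m x <= u (m + n)%N x + (C - u n x).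
  rewrite iterD; apply: (topical_iter _ _ (topical_shift f)) => z.
  by rewrite ffunE; have := HC n x z; lra.
by rewrite ler_norml; apply/andP; split; lra.
Qed.

End Shift.

Lemma absorbing_weakly_ergodic : top_class_absorbing T -> weakly_ergodic T.
Proof.
move=> abs f; have [C HC] := span_bounded f abs.
have cvgf x : cvgn (fun k => upper_avg T f k x).
  by apply: almost_additive_cvg (almost_additive_shift f C HC x).
split=> // x y.
apply: (@bounded_diff_lim _ (fun k => iter k.+1 (shift_op T f) 0 x)
  (fun k => iter k.+1 (shift_op T f) 0 y) C); [|exact: cvgf..].
by move=> k; rewrite ler_norml lerNl opprB !HC.
Qed.

(** * Averages of indicators and closed sets *)

Definition forward_closed (A : {set X}) : Prop :=
  forall x y, x \in A -> edge T x y -> y \in A.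

Lemma upper_avg_le0 (A B : {set X}) k x :
  forward_closed B -> [disjoint A & B] -> x \in B ->
  upper_avg T (ind R A) k x <= 0.
Proof.
move=> Bcl AB xB; rewrite /upper_avg pmulr_rle0 ?invr_gt0//.
(* The summand [0] puts the induction hypothesis in the shape of [iter_le_affine]. *)
suff H : forall n z, iter n (shift_op T (ind R A)) 0 z <= n%:R * ind R (~: B)%SET z + 0.
  by apply: le_trans (H _ _) _; rewrite addr0 ffunE inE xB mulr0.
elim=> [|n IH] z; first by rewrite /= ffunE mul0r add0r.
rewrite iterS {1}/shift_op ffunE.
have le1 := @iter_le_affine 1 _ _ _ _ z (ler0n R n) IH.
move: le1 => /= le1.
case: (boolP (z \in B)) => zB.
  have le2 : T (ind R (~: B)%SET) z <= 0.
    apply: upper_ind_le0 => y; rewrite inE; apply: contra; exact: Bcl.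
  have := mulr_ge0_le0 (ler0n R n) le2.
  rewrite [ind R A z]ffunE [ind R (~: B)%SET z]ffunE inE zB.
  have -> : (z \in A) = false by apply: disjointFl AB zB.
  by rewrite /= ?mulr0n ?mulr1n; lra.
have := ind_le1 A z.
have le2 : T (ind R (~: B)%SET) z <= 1 by apply: bound_upper => ?; apply: ind_le1.
have := ler_wpM2l (ler0n R n) le2.
rewrite [ind R (~: B)%SET z]ffunE inE zB -natr1.
by rewrite /= ?mulr0n ?mulr1n; lra.
Qed.

Lemma upper_avg_ge1 (A : {set X}) k x :
  forward_closed A -> x \in A -> 1 <= upper_avg T (ind R A) k x.
Proof.
move=> Acl xA; rewrite /upper_avg mulrC ler_pdivlMr// mul1r.
suff H : forall n z, n%:R * ind R A z + 0 <= iter n (shift_op T (ind R A)) 0 z.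
  by apply: (le_trans _ (H _ _)); rewrite addr0 ffunE xA mulr1.
elim=> [|n IH] z; first by rewrite mul0r add0r /= ffunE.
rewrite iterS {1}/shift_op [in leRHS]ffunE.
have ge1 := @iter_ge_affine 1 _ _ _ _ z (ler0n R n) IH.
move: ge1 => /= ge1.
case: (boolP (z \in A)) => zA.
  have le1 : T (ind R (~: A)%SET) z <= 0.
    apply: upper_ind_le0 => y; rewrite inE; apply: contra; exact: Acl.
  (* As [T] is only subadditive, [T I_A >= 1] comes from [1 <= T I_A + T I_(~A)] and
     [T I_(~A) <= 0]. *)
  have ge2 : 1 <= T (ind R A + ind R (~: A)%SET) z.
    apply: (@iter_const_ge 1) => w; rewrite !ffunE inE.
    by case: (w \in A); rewrite ?addr0 ?add0r.
  have sub := coherent_subadd hT (ind R A) (ind R (~: A)%SET) z.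
  have {}ge2 : 1 <= T (ind R A) z by lra.
  have := ler_wpM2l (ler0n R n) ge2.
  rewrite [ind R A z]ffunE zA -natr1.
  by rewrite /= ?mulr0n ?mulr1n; lra.
have ge2 : 0 <= T (ind R A) z by apply: (@iter_const_ge 1) => ?; apply: ind_ge0.
have := mulr_ge0 (ler0n R n) ge2.
rewrite [ind R A z]ffunE (negPf zA) -natr1.
by rewrite /= ?mulr0n ?mulr1n; lra.
Qed.

Lemma weakly_ergodic_sep (f : L) x y : weakly_ergodic T ->
  (forall k, 1 <= upper_avg T f k x) -> (forall k, upper_avg T f k y <= 0) ->
  False.
Proof.
move=> /(_ f)[cf /(_ x y) lf] f1 f0.
have ge1 : 1 <= limn (fun k => upper_avg T f k x).
  by apply: limr_ge; [exact: cf | exact: nearW].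
have le0 : limn (fun k => upper_avg T f k y) <= 0.
  by apply: limr_le; [exact: cf | exact: nearW].
by move: ge1; rewrite lf => /le_trans /(_ le0); rewrite ler10.
Qed.

(** * Existence of a top class *)

Definition descendants (x : X) : {set X} := [set y | connect (edge T) x y]%SET.

Lemma descendants_closed x : forward_closed (descendants x).
Proof.
by move=> y z; rewrite !inE => xy yz; apply: connect_trans xy (connect1 yz).
Qed.

Lemma weakly_ergodic_common_descendant x y : weakly_ergodic T ->
  exists w, connect (edge T) x w /\ connect (edge T) y w.
Proof.
move=> we; case: (boolP [disjoint descendants x & descendants y]) => [dis|].
  exfalso; apply: (@weakly_ergodic_sep (ind R (descendants x)) x y we) => k.
    by apply: upper_avg_ge1; [exact: descendants_closed | rewrite inE].
  by apply: (upper_avg_le0 _ _ _ _ _ dis); [exact: descendants_closed | rewrite inE].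
by case/pred0Pn => w /andP[]; rewrite !inE; exists w.
Qed.

(** A state [z] with fewest descendants works: any common descendant [w] of [z] and [y] has the same
    descendants as [z], so [y] leads to [z] through [w]. *)
Lemma weakly_ergodic_top_class : (0 < #|X|)%N -> weakly_ergodic T ->
  has_top_class T.
Proof.
move=> /card_gt0P[x0 _] we.
case: (@arg_minnP _ x0 xpredT (fun z => #|descendants z|) isT) => z _ zmin.
apply/finset.set0Pn; exists z; rewrite inE; apply/forallP => y.
have [w [zw yw]] := weakly_ergodic_common_descendant z y we.
have sub : descendants w \subset descendants z.
  by apply/fintype.subsetP => v; rewrite !inE; apply: connect_trans.
have /eqP ewz : descendants w == descendants z.
  by rewrite eqEcard sub zmin.
have : z \in descendants w by rewrite ewz inE.
by rewrite inE; apply: connect_trans.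
Qed.

(** * Absorption into the top class *)

Lemma top_class_closed : forward_closed (top_class T).
Proof.
move=> x y; rewrite !inE => /forallP xR xy; apply/forallP => z.
exact: connect_trans (xR z) (connect1 xy).
Qed.

(* Mass that is still outside a closed set [B] at time [k] was outside [B] at
   all earlier times too, hence the factor [k.+1]. *)
Lemma upper_avg_ge_iter (B : {set X}) k x : forward_closed B ->
  iter k T (ind R (~: B)%SET) x <= upper_avg T (ind R (~: B)%SET) k x.
Proof.
move=> Bcl; set g := ind R (~: B)%SET.
have gB n z : iter n T g z <= g z.
  case: (boolP (z \in B)) => zB; last first.
    have -> : g z = 1 by rewrite ffunE inE zB.
    by apply: iter_const_le => ?; apply: ind_le1.
  elim: n z zB => [//|n IH] z zB.
  have le1 w : iter n T g w <= 1 * g w + 0.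
    rewrite mul1r addr0; case: (boolP (w \in B)) => [/IH//|wB].
    have -> : g w = 1 by rewrite ffunE inE wB.
    by apply: iter_const_le => ?; apply: ind_le1.
  have := @iter_le_affine 1 _ _ _ _ z ler01 le1 => /= le2.
  apply: le_trans le2 _; rewrite mul1r addr0 [leRHS]ffunE inE zB.
  by apply: upper_ind_le0 => y; rewrite inE; apply: contra; apply: Bcl.
rewrite /upper_avg mulrC ler_pdivlMr//.
suff H : forall n z, n.+1%:R * iter n T g z + 0 <= iter n.+1 (shift_op T g) 0 z.
  by have := H k x; rewrite addr0 mulrC.
elim=> [|n IH] z.
  rewrite mul1r addr0 /shift_op /= [in leRHS]ffunE lerDl.
  by apply: (@iter_const_ge 1) => ?; rewrite ffunE.
rewrite iterS {1}/shift_op [in leRHS]ffunE.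
have := @iter_ge_affine 1 _ _ _ _ z (ler0n R n.+1) IH.
(* The added [g] dominates [T^(n+1) g], raising the coefficient by one. *)
have := gB n.+1 z; rewrite -(natr1 n.+1) /=.
by lra.
Qed.

Lemma weakly_ergodic_absorbing : (0 < #|X|)%N -> weakly_ergodic T ->
  top_class_absorbing T.
Proof.
move=> hX we; have htop := weakly_ergodic_top_class hX we; split=> // x xR.
apply: contrapT => nabs.
have [y yR] := finset.set0Pn _ htop.
apply: (@weakly_ergodic_sep (ind R (~: top_class T)%SET) x y we) => k.
  apply: (le_trans _ (upper_avg_ge_iter _ _ _ top_class_closed)).
  (* Absorption concerns positive powers only; at [k = 0] the indicator itself is [1] at [x]. *)
  case: k => [|k]; first by rewrite /= ffunE xR.
  by rewrite leNgt; apply/negP => lt1; apply: nabs; exists k.+1.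
apply: (upper_avg_le0 _ _ _ _ top_class_closed) yR.
by rewrite disjoint_sym finset.disjoints_subset finset.setCK.
Qed.

End UpperTransition.

Theorem theorem4 (R : realType) (X : finType) (hX : (0 < #|X|)%N)
    (T : {ffun X -> R} -> {ffun X -> R}) (hT : coherent T) :
  weakly_ergodic T <-> top_class_absorbing T.
Proof.
split; first exact: weakly_ergodic_absorbing.
exact: absorbing_weakly_ergodic.
Qed.
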